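(* Let $G$ be a real skew-symmetric $n\times n$ matrix and $K$ a real symmetric $n\times n$ matrix, and consider the gyroscopic conservative system $$\ddot{\mathbf q}+G\dot{\mathbf q}+K\mathbf q=\mathbf 0,\qquad \mathbf q(t)\in\mathbb{R}^n.$$ If $$2n\big(2\|K\|^2+\|G^2\|^2+4\operatorname{Tr}(G^TKG)\big)<\big(2\operatorname{Tr}(K)+\|G\|^2\big)^2,$$ then the equilibrium point $\mathbf q=\mathbf 0,\ \dot{\mathbf q}=\mathbf 0$ of this system is unstable.
   Context: For a real matrix $A=[a_{ij}]$, $\|A\|^2=\sum_{i,j}a_{ij}^2=\operatorname{Tr}(AA^T)$ (Frobenius norm). ''Unstable'' means not stable in the sense of Lyapunov, for the associated first-order linear system in the variables $(\mathbf q,\dot{\mathbf q})\in\mathbb{R}^{2n}$. *)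

(* Defs.v *)
From HB Require Import structures.
From mathcomp Require Import all_boot all_order all_algebra.
From mathcomp Require Import all_classical all_reals all_analysis.
Set Implicit Arguments.
Unset Strict Implicit.
Unset Printing Implicit Defensive.
Import Order.TTheory GRing.Theory Num.Theory.
Import numFieldNormedType.Exports.
Local Open Scope classical_set_scope.
Local Open Scope ring_scope.

(* Squared Frobenius norm; the library norm `|A| on matrices is the sup norm. *)
Definition frobenius_sq {R : realType} {m n : nat} (A : 'M[R]_(m, n)) : R :=
  \sum_(i < m) \sum_(j < n) A i j ^+ 2.

Definition gyroscopic_solution {R : realType} {n : nat} (G K : 'M[R]_n)
    (q : R -> 'cV[R]_n) : Prop :=
  forall t : R,
    [/\ derivable q t 1, derivable (derive1 q) t 1
      & derive1 (derive1 q) t + G *m derive1 q t + K *m q t = 0].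

Definition phase_curve {R : realType} {n : nat} (q : R -> 'cV[R]_n) (t : R) :
    'cV[R]_(n + n) :=
  col_mx (q t) (derive1 q t).

(* The motions of the associated first-order linear system in the variables
   (q, q'), cf. [gyroscopic_motionsP]. Since the system is linear, every
   solution extends to the whole line, so only global ones are considered. *)
Definition gyroscopic_motions {R : realType} {n : nat} (G K : 'M[R]_n) :
    set (R -> 'cV[R]_(n + n)) :=
  [set phase_curve q | q in [set q | gyroscopic_solution G K q]].

Lemma is_derive_mxP {R : realType} {m n : nat} (x : R -> 'M[R]_(m, n))
    (t : R) (d : 'M[R]_(m, n)) :
  is_derive t 1 x d <-> forall i j, is_derive t 1 (fun s => x s i j) (d i j).
Proof.
split=> [[dx <-] i j|dx].
  split; first by move/derivable_mxP: dx.
  by rewrite derive_mx // mxE.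
have xd : derivable x t 1 by apply/derivable_mxP => i j; have [] := dx i j.
split=> //; rewrite derive_mx //; apply/matrixP => i j; rewrite mxE.
by have [_] := dx i j.
Qed.

Lemma is_derive_col_mxP {R : realType} {n : nat} (u v : R -> 'cV[R]_n)
    (t : R) (a b : 'cV[R]_n) :
  is_derive t 1 (fun s => col_mx (u s) (v s)) (col_mx a b) <->
  is_derive t 1 u a /\ is_derive t 1 v b.
Proof.
split=> [/is_derive_mxP d|[/is_derive_mxP du /is_derive_mxP dv]].
  split; apply/is_derive_mxP => i j.
  - by have := d (lshift n i) j; under eq_fun do rewrite col_mxEu; rewrite col_mxEu.
  - by have := d (rshift n i) j; under eq_fun do rewrite col_mxEd; rewrite col_mxEd.
apply/is_derive_mxP => i j; case: (split_ordP i) => k ->.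
- by under eq_fun do rewrite col_mxEu; rewrite col_mxEu.
- by under eq_fun do rewrite col_mxEd; rewrite col_mxEd.
Qed.

Lemma gyroscopic_motionsP {R : realType} {n : nat} (G K : 'M[R]_n)
    (x : R -> 'cV[R]_(n + n)) :
  gyroscopic_motions G K x <->
  forall t : R, is_derive t 1 x (block_mx 0 1%:M (- K) (- G) *m x t).
Proof.
split=> [[q sol <-] t|dx].
  have [dq ddq eq] := sol t.
  rewrite /phase_curve mul_block_col mul0mx mul1mx add0r.
  apply/is_derive_col_mxP; split; split;
    [exact: dq|by rewrite derive1E|exact: ddq|].
  rewrite -derive1E; apply/eqP; rewrite -subr_eq0 !mulNmx opprD !opprK.
  by rewrite (addrC (K *m _)) addrA eq.
pose q t := usubmx (x t); pose v t := dsubmx (x t).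
have xE : x = fun t => col_mx (q t) (v t) by apply/funext => t; rewrite vsubmxK.
have d (t : R) : is_derive t 1 q (v t) /\ is_derive t 1 v (- K *m q t - G *m v t).
  apply/is_derive_col_mxP; rewrite -xE; have := dx t.
  have -> : x t = col_mx (q t) (v t) by rewrite vsubmxK.
  by rewrite mul_block_col mul0mx mul1mx add0r -[in X in _ -> X]mulNmx.
have qE : derive1 q = v.
  by apply/funext => t; rewrite derive1E; have [[_ ->]] := d t.
exists q; last by rewrite /phase_curve qE xE.
move=> t; rewrite qE; have [[dq _] [dv eq]] := d t; split; [exact: dq|exact: dv|].
by rewrite derive1E eq mulNmx subrK addNr.
Qed.

(* Stability of the point x0 for an autonomous system given by its set of
   motions X; by autonomy the initial time may be taken to be 0. In finite
   dimension the choice of the norm is immaterial. *)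
Definition lyapunov_stable {R : realType} {V : normedModType R}
    (X : set (R -> V)) (x0 : V) : Prop :=
  forall eps : R, 0 < eps ->
    exists2 delta : R, 0 < delta &
      forall x : R -> V, X x -> `|x 0 - x0| < delta ->
        forall t : R, 0 <= t -> `|x t - x0| < eps.

Definition lyapunov_unstable {R : realType} {V : normedModType R}
    (X : set (R -> V)) (x0 : V) : Prop :=
  ~ lyapunov_stable X x0.

(* Main.v *)
Require Import Defs.
From mathcomp Require Import all_boot all_order all_algebra.
From mathcomp Require Import all_classical all_reals all_analysis.
From mathcomp Require Import complex ring lra.
Import Order.TTheory GRing.Theory Num.Theory.
Import numFieldNormedType.Exports.
Local Open Scope ring_scope.

(** Written as a first-order system x' = A x with x = (q, q'), the equation has
    the matrix A = [[0, 1], [-K, -G]], and a block computation gives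
      tr A^2 = - (2 tr K + |G|^2),
      tr A^4 = 2 |K|^2 + |G^2|^2 + 4 tr (G^T K G),
    so the hypothesis says exactly 2n tr A^4 < (tr A^2)^2.

    If all 2n eigenvalues of A were of the form i y with y real, then
    tr A^2 = - sum y^2 and tr A^4 = sum y^4, and the Cauchy-Schwarz inequality
    would give (tr A^2)^2 <= 2n tr A^4. Hence some eigenvalue has a
    nonzero real part ([trace_eigenvalue_offaxis]).

    The system is Hamiltonian: S A = - A^T S for an invertible (symplectic)
    matrix S, so the spectrum of A is stable under l |-> - l
    ([eigenvalue_opp]) and some eigenvalue s + i w has s > 0. The real and
    imaginary parts of exp((s + i w) t) v, for an eigenvector v, are then real
    motions which can start arbitrarily close to 0 but do not both stay bounded
    ([unstable_of_spiral]). *)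

(** * Traces of powers and eigenvalues off the imaginary axis *)

Lemma trig_mxX (R : comNzRingType) (n : nat) (T : 'M[R]_n) (k : nat) :
  is_trig_mx T ->
  is_trig_mx (T ^+ k) /\ forall i, (T ^+ k) i i = T i i ^+ k.
Proof.
move=> /is_trig_mxP Ttrig; elim: k => [|k [/is_trig_mxP IHtrig IHdiag]].
  split=> [|i]; last by rewrite !expr0 mxE eqxx.
  by rewrite expr0; exact: scalar_mx_is_trig.
split=> [|i]; first apply/is_trig_mxP => i j ltij.
  rewrite exprS mxE big1 // => l _; case: (ltnP i l) => [ltil|leli].
    by rewrite Ttrig ?mul0r.
  by rewrite IHtrig ?mulr0 // (leq_ltn_trans leli).
rewrite [in LHS]exprS mxE (bigD1 i) //= IHdiag -exprS big1 ?addr0 // => l.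
rewrite -val_eqE neq_ltn /= => /orP[ltli|ltil].
  by rewrite IHtrig ?mulr0.
by rewrite Ttrig ?mul0r.
Qed.

(** A unitary change of basis makes A triangular; its diagonal entries are then
    the eigenvalues of A with multiplicity, and their powers are the diagonal
    entries of the powers. *)
Lemma trace_powers_eigenvalues (C : numClosedFieldType) (n : nat)
    (A : 'M[C]_n) :
  exists2 mu : 'I_n -> C, forall i, eigenvalue A (mu i) &
    forall k, \tr (A ^+ k) = \sum_i mu i ^+ k.
Proof.
have [P /unitarymx_unit Pu] : exists2 P : 'M[C]_n, P \is unitarymx &
    all [pred A | similar_trig P A] [:: A].
  by apply: cotrigonalization => ? ? /[!inE] /eqP -> /eqP ->.
rewrite /= andbT /similar_to => Ttrig; set T := conjmx P A in Ttrig.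
have TE : T = P *m A *m invmx P by rewrite /T conjumx.
exists (fun i => T i i) => [i|k].
  have: eigenvalue T (T i i).
    rewrite eigenvalue_root_char char_poly_trig //.
    apply/rootP; rewrite horner_prod; apply/eqP/prodf_eq0.
    by exists i => //; rewrite hornerXsubC subrr.
  by apply: eigenvalue_conjmx; rewrite ?stablemx_unit ?row_free_unit.
have TkE : T ^+ k = P *m (A ^+ k) *m invmx P.
  elim: k => [|k IH]; first by rewrite !expr0 mulmx1 mulmxV.
  by rewrite !exprS IH TE -!mulmxE !mulmxA mulmxKV.
have [_ diagT] := @trig_mxX _ _ _ k Ttrig.
rewrite -(eq_bigr _ (fun i _ => diagT i)) -[RHS]/(\tr (T ^+ k)) TkE.
by rewrite mxtrace_mulC mulmxA mulVmx // mul1mx.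
Qed.

(** Cauchy-Schwarz against the constant vector 1: the difference of the two
    sides is half the sum of all (x i - x j) ^+ 2. *)
Lemma sqr_sum_le (R : realDomainType) (n : nat) (x : 'I_n -> R) :
  (\sum_i x i) ^+ 2 <= n%:R * \sum_i x i ^+ 2.
Proof.
have : 0 <= \sum_i \sum_j (x i - x j) ^+ 2.
  by do 2!apply: sumr_ge0 => ? _; exact: sqr_ge0.
have -> : \sum_i \sum_j (x i - x j) ^+ 2 =
    2 * (n%:R * \sum_i x i ^+ 2 - (\sum_i x i) ^+ 2).
  under eq_bigr do under eq_bigr do rewrite sqrrB.
  under eq_bigr do rewrite big_split sumrB /= sumr_const card_ord sumrMnl
    -mulr_sumr.
  rewrite big_split sumrB /= sumr_const card_ord !sumrMnl -mulr_suml.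
  by rewrite expr2 [_%:R * _]mulr_natl mulr2n; ring.
by rewrite pmulr_rge0 // subr_ge0.
Qed.

(** A purely imaginary spectrum makes the squares of the eigenvalues real, and
    for real numbers the Cauchy-Schwarz inequality bounds the square of their
    sum; the strict reverse inequality is thus a certificate that the spectrum
    leaves the imaginary axis. *)
Lemma trace_eigenvalue_offaxis (R : rcfType) (n : nat) (A : 'M[R]_n) :
  n%:R * \tr (A ^+ 4) < (\tr (A ^+ 2)) ^+ 2 ->
  exists2 l : R[i], eigenvalue (map_mx (real_complex R) A) l &
    complex.Re l != 0.
Proof.
set AC := map_mx _ A => ltA; apply/not_exists2P => imag.
have [mu eig trE] := trace_powers_eigenvalues _ _ AC.
have trC k : \tr (AC ^+ k) = real_complex R (\tr (A ^+ k)).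
  have -> : AC ^+ k = map_mx (real_complex R) (A ^+ k).
    elim: k => [|k IH]; first by rewrite !expr0 map_mx1.
    by rewrite !exprS IH -!mulmxE map_mxM.
  by rewrite trace_map_mx.
pose y i := complex.Im (mu i).
have muX2 i : mu i ^+ 2 = real_complex R (- y i ^+ 2).
  have /eqP : complex.Re (mu i) = 0.
    by case: (imag (mu i)) => [/(_ (eig i))|/negP/negPn/eqP].
  rewrite /y; case: (mu i) => a b /= /eqP ->.
  by rewrite expr2; congr Complex; rewrite /=; ring.
have tr2 : \tr (A ^+ 2) = \sum_i - y i ^+ 2.
  apply: complexI; rewrite -trC trE rmorph_sum; exact: eq_bigr.
have tr4 : \tr (A ^+ 4) = \sum_i (- y i ^+ 2) ^+ 2.
  apply: complexI; rewrite -trC trE rmorph_sum; apply: eq_bigr => i _.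
  by rewrite (exprM _ 2 2) muX2 -rmorphXn.
by move: ltA; rewrite ltNge tr2 tr4 sqr_sum_le.
Qed.

(** * Eigenvalues of matrices with a Hamiltonian symmetry *)

Lemma eigenvalue_trmx (F : fieldType) (n : nat) (A : 'M[F]_n) :
  eigenvalue A^T =1 eigenvalue A.
Proof.
move=> l; rewrite !eigenvalue_root_char /char_poly -(det_tr (char_poly_mx A)).
by rewrite {2}/char_poly_mx linearB /= tr_scalar_mx map_trmx.
Qed.

(** [eigenvalue] speaks of row eigenvectors, while the exponential solutions of
    x' = A x need column eigenvectors. *)
Lemma eigenvalue_right (F : fieldType) (n : nat) (A : 'M[F]_n) (l : F) :
  eigenvalue A l -> exists2 w : 'cV[F]_n, A *m w = l *: w & w != 0.
Proof.
rewrite -eigenvalue_trmx => /eigenvalueP[v vA v0].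
exists v^T; last by rewrite trmx_eq0.
by apply: trmx_inj; rewrite trmx_mul trmxK vA linearZ /= trmxK.
Qed.

(** The relation says that A is conjugate to - A^T, which has the opposite
    spectrum. *)
Lemma eigenvalue_opp (F : fieldType) (n : nat) (A S : 'M[F]_n) (l : F) :
  S \in unitmx -> S *m A = - (A^T *m S) -> eigenvalue A l -> eigenvalue A (- l).
Proof.
move=> Su SA; rewrite -eigenvalue_trmx => /eigenvalueP[v vA v0].
apply/eigenvalueP; exists (v *m S).
  by rewrite -mulmxA SA mulmxN mulmxA vA -scalemxAl scaleNr.
by apply: contraNneq v0 => vS0; rewrite -(mulmxK Su v) vS0 mul0mx.
Qed.

(** * Growing motions and instability *)

Section Growth.
Context {R : realType}.

(** The curve is the real part of exp((s + i w) u) (a + i b), and the hypotheses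
    are the two parts of A (a + i b) = (s + i w) (a + i b). *)
Lemma spiral_solution (n : nat) (A : 'M[R]_n) (a b : 'cV[R]_n) (s w : R) :
  A *m a = s *: a - w *: b -> A *m b = w *: a + s *: b ->
  forall t : R,
  let x u := expR (s * u) *: (cos (w * u) *: a - sin (w * u) *: b) in
  is_derive t 1 x (A *m x t).
Proof.
move=> Aa Ab t x; rewrite {2}/x -scalemxAr mulmxBr -!scalemxAr Aa Ab.
apply/is_derive_mxP => i j.
have dlin (c : R) : is_derive t (1 : R) ( *%R c) c.
  have -> : *%R c = (cst c : R -> R) * id by apply/funext.
  apply: is_derive_eq.
  by rewrite scaler0 addr0 /GRing.scale /= mulr1.
have de : is_derive t (1 : R) (expR \o *%R s) (expR (s * t) * s).
  exact: is_derive1_comp.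
have dc : is_derive t (1 : R) (cos \o *%R w) (- sin (w * t) * w).
  exact: is_derive1_comp.
have ds : is_derive t (1 : R) (sin \o *%R w) (cos (w * t) * w).
  exact: is_derive1_comp.
have -> : (fun u => x u i j) = (expR \o *%R s) *
    ((cos \o *%R w) * cst (a i j) - (sin \o *%R w) * cst (b i j)).
  by apply/funext => u; rewrite /x !mxE /= !fctE.
apply: is_derive_eq.
by rewrite !mxE /GRing.scale /= !fctE; ring.
Qed.

(** A single spiralling motion may vanish at some times, when a and b are
    proportional. So two motions a quarter turn apart are followed, starting at
    c a and c b: a rotation recovers exp(s t) c a and exp(s t) c b from them, and
    these would have norm less than 2 for all t >= 0 if both motions stayed in
    the unit ball. *)
Lemma unstable_of_spiral (n : nat) (A : 'M[R]_n) (a b : 'cV[R]_n) (s w : R) :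
  A *m a = s *: a - w *: b -> A *m b = w *: a + s *: b ->
  0 < s -> 0 < `|a| + `|b| ->
  lyapunov_unstable
    [set x : R -> 'cV[R]_n | forall t : R, is_derive t 1 x (A *m x t)]%classic
    (0 : 'cV[R]_n).
Proof.
move=> Aa Ab s0 m0 /(_ 1 ltr01)[d d0 stab]; set m := `|a| + `|b| in m0.
have m10 : 0 < m + 1 by lra.
pose c := d / (m + 1); have c0 : 0 < c by exact: divr_gt0.
have cm : c * m < d.
  by rewrite /c mulrAC ltr_pdivrMr // ltr_pM2l // ltrDl.
have small (v : 'cV[R]_n) : `|v| <= m -> `|c *: v| < d.
  move=> vm; rewrite normrZ gtr0_norm // (le_lt_trans _ cm) //.
  by rewrite ler_pM2l.
have bnd (p q : 'cV[R]_n) (t : R) : A *m p = s *: p - w *: q ->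
    A *m q = w *: p + s *: q -> `|p| <= m -> 0 <= t ->
    `|expR (s * t) *: (cos (w * t) *: (c *: p) - sin (w * t) *: (c *: q))| < 1.
  move=> Ap Aq pm t0; rewrite -[X in `|X|]subr0.
  apply: (stab (fun u => expR (s * u) *:
    (cos (w * u) *: (c *: p) - sin (w * u) *: (c *: q)))) => //.
    move=> u; apply: spiral_solution.
      by rewrite -scalemxAr Ap scalerBr !scalerA !(mulrC c).
    by rewrite -scalemxAr Aq scalerDr !scalerA !(mulrC c).
  by rewrite subr0 !mulr0 expR0 cos0 sin0 scale0r subr0 !scale1r; exact: small.
(* Chosen so that s * t = 4 / (c * m) and hence exp(s * t) * (c * m) > 4. *)
pose t := 4 / (c * m * s).
have cm0 : 0 < c * m by exact: mulr_gt0.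
have t0 : 0 <= t by apply/ltW/divr_gt0 => //; exact: mulr_gt0.
have am : `|a| <= m by rewrite /m lerDl.
have bm : `|b| <= m by rewrite /m lerDr.
have := bnd a b t Aa Ab am t0.
(* - i (a + i b) = b - i a is an eigenvector too: its real part starts at b. *)
have := bnd b (- a) t _ _ bm t0.
rewrite !mulmxN Aa Ab !scalerN opprK opprB => /(_ (addrC _ _) erefl).
set e := expR _; set C := cos _; set S := sin _.
set y := _ *: _ => y1; set x := _ *: _ => x1.
have csE : C ^+ 2 + S ^+ 2 = 1 by rewrite /C /S cos2Dsin2.
have aE : (e * c) *: a = C *: x + S *: y.
  apply/matrixP => i j; rewrite !mxE -[LHS]mul1r -csE; ring.
have bE : (e * c) *: b = C *: y - S *: x.
  apply/matrixP => i j; rewrite !mxE -[LHS]mul1r -csE; ring.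
have mixed (p q : 'cV[R]_n) (k l : R) : `|p| < 1 -> `|q| < 1 -> `|k| <= 1 ->
    `|l| <= 1 -> `|k *: p + l *: q| < 2.
  move=> p1 q1 k1 l1; apply: le_lt_trans (ler_normD _ _) _; rewrite !normrZ.
  by have := normr_ge0 p; have := normr_ge0 q; nra.
have C1 : `|C| <= 1 by rewrite ler_norml cos_geN1 cos_le1.
have S1 : `|S| <= 1 by rewrite ler_norml sin_geN1 sin_le1.
have ec0 : 0 < e * c by rewrite mulr_gt0 ?expR_gt0.
have a2 : e * c * `|a| < 2.
  by rewrite -(gtr0_norm ec0) -normrZ aE; exact: mixed.
have b2 : e * c * `|b| < 2.
  by rewrite -(gtr0_norm ec0) -normrZ bE -scaleNr; apply: mixed; rewrite ?normrN.
have : e * (c * m) < 4 by rewrite mulrA /m mulrDr; lra.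
apply/negP; rewrite -leNgt -ler_pdivrMr //.
apply: le_trans (expR_ge1Dx _); have -> : s * t = 4 / (c * m).
  rewrite /t; field; do ?[apply/andP; split]; exact: lt0r_neq0.
by rewrite lerDr.
Qed.

End Growth.

Lemma complex_eigenvector_parts (R : rcfType) (n : nat) (A : 'M[R]_n)
    (l : R[i]) (v : 'cV[R[i]]_n) :
  map_mx (real_complex R) A *m v = l *: v ->
  let a := map_mx (@complex.Re R) v in let b := map_mx (@complex.Im R) v in
  A *m a = complex.Re l *: a - complex.Im l *: b /\
  A *m b = complex.Im l *: a + complex.Re l *: b.
Proof.
move=> /matrixP Av a b.
have ReA : map_mx (@complex.Re R) (map_mx (real_complex R) A *m v) = A *m a.
  apply/matrixP => i j; rewrite !mxE [LHS](raddf_sum (@complex.Re R)).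
  apply: eq_bigr => k _; rewrite !mxE.
  by case: (v k j) => p q /=; rewrite mul0r subr0.
have ImA : map_mx (@complex.Im R) (map_mx (real_complex R) A *m v) = A *m b.
  apply/matrixP => i j; rewrite !mxE [LHS](raddf_sum (@complex.Im R)).
  apply: eq_bigr => k _; rewrite !mxE.
  by case: (v k j) => p q /=; rewrite mul0r addr0.
split; [rewrite -ReA|rewrite -ImA]; apply/matrixP => i j; rewrite mxE Av !mxE.
  by case: (l) (v i j) => s w [p q].
by case: (l) (v i j) => s w [p q] /=; rewrite addrC.
Qed.

(** * The gyroscopic system *)

Definition phase_matrix {R : pzRingType} {n : nat} (G K : 'M[R]_n) :
    'M[R]_(n + n) :=
  block_mx 0 1%:M (- K) (- G).

(** The canonical symplectic form of the variables (q, p), p = q' + G q / 2,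
    expressed in the variables (q, q'). *)
Definition gyroscopic_form {R : pzRingType} {n : nat} (G : 'M[R]_n) :
    'M[R]_(n + n) :=
  block_mx G 1%:M (- 1%:M) 0.

Lemma frobenius_sqE (R : realType) (m n : nat) (A : 'M[R]_(m, n)) :
  frobenius_sq A = \tr (A *m A^T).
Proof.
rewrite /mxtrace; apply: eq_bigr => i _; rewrite mxE.
by apply: eq_bigr => j _; rewrite mxE expr2.
Qed.

Lemma mxtraceN (R : pzRingType) (n : nat) (A : 'M[R]_n) : \tr (- A) = - \tr A.
Proof. exact: linearN. Qed.

Lemma mxtraceB (R : pzRingType) (n : nat) (A B : 'M[R]_n) :
  \tr (A - B) = \tr A - \tr B.
Proof. exact: linearB. Qed.

Lemma trmxN (R : pzRingType) (m n : nat) (A : 'M[R]_(m, n)) : (- A)^T = - A^T.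
Proof. exact: linearN. Qed.

Section Gyroscopic.
Context {R : realType} {n : nat} (G K : 'M[R]_n).
Context (skewG : G^T = - G) (symK : K^T = K).
Local Notation A := (phase_matrix G K).

Lemma phase_matrixX2 : A ^+ 2 = block_mx (- K) (- G) (G *m K) (G *m G - K).
Proof.
rewrite expr2 -mulmxE mulmx_block !mul0mx !mul1mx !mulmx0 !mulmx1 !add0r.
by rewrite !mulNmx !mulmxN !opprK (addrC (- K)).
Qed.

Lemma trace_phase_matrix2 : \tr (A ^+ 2) = - (2 * \tr K + frobenius_sq G).
Proof.
rewrite phase_matrixX2 mxtrace_block frobenius_sqE skewG mulmxN.
by rewrite !mxtraceB !mxtraceN; ring.
Qed.

Lemma trace_phase_matrix4 : \tr (A ^+ 4) =
  2 * frobenius_sq K + frobenius_sq (G *m G) + 4 * \tr (G^T *m K *m G).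
Proof.
rewrite (exprM _ 2 2) expr2 -mulmxE phase_matrixX2 mulmx_block mxtrace_block.
rewrite !frobenius_sqE trmx_mul symK skewG !mulNmx !mulmxN !opprK.
rewrite mulmxBl !mulmxBr.
have GGK : \tr (G *m (G *m K)) = \tr (G *m K *m G) by exact: mxtrace_mulC.
have KGG : \tr (K *m (G *m G)) = \tr (G *m K *m G).
  by rewrite mxtrace_mulC -(mulmxA G G K) GGK.
rewrite !(mxtraceD, mxtraceB, mxtraceN) -(mulmxA G G K) GGK KGG.
by ring.
Qed.

Lemma gyroscopic_form_unit : gyroscopic_form G \in unitmx.
Proof.
apply: (proj1 (@mulmx1_unit _ _ _ (block_mx 0 (- 1%:M) 1%:M G) _)).
rewrite mulmx_block !mulmx0 !mul0mx !mulmxN !mulNmx !mulmx1 !mul1mx.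
by rewrite !addr0 add0r addNr opprK -scalar_mx_block.
Qed.

(** Both sides are the symmetric matrix diag(- K, - 1), minus the Hessian of
    the energy (|q'|^2 + q^T K q) / 2, which the flow preserves. *)
Lemma gyroscopic_hamiltonian :
  gyroscopic_form G *m A = - (A^T *m gyroscopic_form G).
Proof.
rewrite /phase_matrix tr_block_mx !mulmx_block opp_block_mx.
rewrite trmxN (trmxN _ _ _ G) skewG symK trmx0 trmx1.
rewrite !(mulmx0, mul0mx, mulmxN, mulNmx, mulmx1, mul1mx).
by rewrite !(addr0, add0r, opprK, subrr, oppr0).
Qed.

Lemma gyroscopic_motionsE :
  gyroscopic_motions G K =
  [set x : R -> 'cV[R]_(n + n) | forall t : R, is_derive t 1 x (A *m x t)]%classic.
Proof. by apply/funext => x; apply/propext; exact: gyroscopic_motionsP. Qed.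

End Gyroscopic.

Theorem theorem4p1 (R : realType) (n : nat) (G K : 'M[R]_n)
    (skewG : G^T = - G) (symK : K^T = K)
    (ineq : (2 * n)%:R * (2 * frobenius_sq K + frobenius_sq (G *m G)
                          + 4 * \tr (G^T *m K *m G))
            < (2 * \tr K + frobenius_sq G) ^+ 2) :
  lyapunov_unstable (gyroscopic_motions G K) (0 : 'cV[R]_(n + n)).
Proof.
have [l eigl rel] : exists2 l : R[i],
    eigenvalue (map_mx (real_complex R) (phase_matrix G K)) l &
    complex.Re l != 0.
  apply: trace_eigenvalue_offaxis.
  by rewrite trace_phase_matrix2 // trace_phase_matrix4 // sqrrN addnn -mul2n.
wlog l0 : l eigl {rel} / 0 < complex.Re l.
  move=> IH; move: rel; rewrite neq_lt => /orP[ltl|]; last exact: IH.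
  apply: (IH (- l)); last by case: l {eigl} ltl => a b /=; rewrite oppr_gt0.
  apply: (@eigenvalue_opp _ _ _ (map_mx (real_complex R) (gyroscopic_form G))).
  - by rewrite map_unitmx gyroscopic_form_unit.
  - by rewrite map_trmx -!map_mxM gyroscopic_hamiltonian // map_mxN.
  - by [].
have [v Av v0] := eigenvalue_right _ _ _ _ eigl.
have [Aa Ab] := complex_eigenvector_parts _ _ _ _ _ Av.
rewrite gyroscopic_motionsE; apply: (unstable_of_spiral _ _ _ _ _ _ Aa Ab l0).
rewrite lt0r addr_ge0 // andbT paddr_eq0 // !normr_eq0.
apply: contraNN v0 => /andP[/eqP/matrixP a0 /eqP/matrixP b0].
apply/eqP/matrixP => i j; move: (a0 i j) (b0 i j); rewrite !mxE.
by case: (v i j) => p q /= -> ->.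
Qed.
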